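(* Let $X$ be a strongly regular graph on $n$ vertices. Peak state transfer occurs in the arc-reversal walk on $X$ (i.e. there is peak state transfer between some pair of distinct vertices at some time) if and only if $X$ is isomorphic to one of the following: (a) the disjoint union of $\frac n2$ copies of $K_2$; (b) the complete bipartite graph $K_{\frac n2,\frac n2}$; or (c) the complete tripartite graph $K_{\frac n3,\frac n3,\frac n3}$.
   Context: A strongly regular graph with parameter set $(n,k,a,c)$ is a $k$-regular graph on $n$ vertices, neither complete nor empty, in which every pair of adjacent vertices has $a$ common neighbours and every pair of distinct non-adjacent vertices has $c$ common neighbours. (It may be disconnected.) Arc-reversal walk: let $G=(V,E)$ be a finite simple graph without isolated vertices and $\mathcal{A}$ its set of arcs (ordered pairs $(u,v)$ with $uv\in E$; $u$ is the tail). Let $N\in\mathbb{R}^{\mathcal{A}\times V}$ with $N(a,v)=1/\sqrt{d(v)}$ if $v$ is the tail of $a$ and $0$ otherwise ($d(v)$ is the degree), and let $R$ be the permutation matrix on $\mathcal{A}$ swapping $(u,v)$ and $(v,u)$. The transition matrix is $U=R(2NN^T-I)$. Put $B_t=N^TU^tN$ for integers $t\ge0$, and $B=B_1=D^{-1/2}AD^{-1/2}$, where $A$ is the adjacency matrix and $D$ the diagonal degree matrix. Let $B=\sum_\theta\theta E_\theta$ be the spectral decomposition ($\theta$ over distinct eigenvalues, $E_\theta$ the orthogonal projection onto the $\theta$-eigenspace). For distinct vertices $u,v$ there is peak state transfer from $u$ to $v$ at time $t$ (a positive integer) if $|B_t(u,v)|=\sum_\theta|E_\theta(u,v)|$ and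 $E_\theta(u,v)\neq0$ for at least one $\theta$ (the trivial case where all $E_\theta(u,v)=0$, called zero state transfer, is not counted as peak state transfer). *)

(* Defs.v *)
From HB Require Import structures.
From mathcomp Require Import all_boot all_order all_algebra.
From mathcomp Require Import classical_sets fsbigop reals.

Set Implicit Arguments.
Unset Strict Implicit.
Unset Printing Implicit Defensive.

Import Order.TTheory GRing.Theory Num.Theory.
Local Open Scope ring_scope.

Record sgraph := SGraph {
  vertex :> finType;
  adj : rel vertex;
  adj_sym : symmetric adj;
  adj_irr : irreflexive adj }.

Section Graphs.
Variable G : sgraph.

Definition deg (u : G) : nat := #|[set v | adj u v]|.

Definition common_nbrs (u v : G) : nat := #|[set w | adj u w && adj v w]|.

Definition is_empty_graph : Prop := forall u v : G, ~~ adj u v.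

Definition is_complete_graph : Prop := forall u v : G, u != v -> adj u v.

Definition strongly_regular (n k a c : nat) : Prop :=
  [/\ #|G| = n, ~ is_complete_graph, ~ is_empty_graph,
      forall u : G, deg u = k
    & forall u v : G, u != v -> common_nbrs u v = if adj u v then a else c].

End Graphs.

Definition graph_iso (G H : sgraph) : Prop :=
  exists2 f : G -> H, bijective f & forall u v, adj (f u) (f v) = adj u v.

Section Families.
Variables m r : nat.

(* m disjoint copies of K_r: the first component names the copy. *)
Definition copies_rel : rel ('I_m * 'I_r) :=
  fun u v => (u.1 == v.1) && (u.2 != v.2).

Fact copies_sym : symmetric copies_rel.
Proof. by move=> u v; rewrite /copies_rel eq_sym (eq_sym u.2). Qed.

Fact copies_irr : irreflexive copies_rel.
Proof. by move=> u; rewrite /copies_rel !eqxx. Qed.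

Definition copies_of_complete : sgraph := SGraph copies_sym copies_irr.

(* r parts of size m each: the first component names the part. *)
Definition multipartite_rel : rel ('I_r * 'I_m) := fun u v => u.1 != v.1.

Fact multipartite_sym : symmetric multipartite_rel.
Proof. by move=> u v; rewrite /multipartite_rel eq_sym. Qed.

Fact multipartite_irr : irreflexive multipartite_rel.
Proof. by move=> u; rewrite /multipartite_rel eqxx. Qed.

Definition complete_multipartite : sgraph :=
  SGraph multipartite_sym multipartite_irr.

End Families.

Section OrthogonalProjection.
Variables (R : realType) (n : nat).

(* The projection onto the row space of W along its orthogonal complement
   {x | x *m W^T = 0}. Matrices act on row vectors here; this is immaterial
   below, since the projected matrices are symmetric. *)
Definition ortho_proj (W : 'M[R]_n) : 'M[R]_n := proj_mx W (kermx W^T).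

End OrthogonalProjection.

Section ArcReversalWalk.
Variables (R : realType) (G : sgraph).

Definition graph_arc := {p : G * G | adj p.1 p.2}.

(* Rows and columns are indexed by arcs and vertices through enum_val. *)
Definition arc_at (i : 'I_#|{: graph_arc}|) : G * G := val (enum_val i).

Definition tail_mx : 'M[R]_(#|{: graph_arc}|, #|G|) :=
  \matrix_(i, j) if (arc_at i).1 == enum_val j
                 then (Num.sqrt (deg (enum_val j))%:R)^-1 else 0.

Definition reversal_mx : 'M[R]_#|{: graph_arc}| :=
  \matrix_(i, j) (arc_at j == ((arc_at i).2, (arc_at i).1))%:R.

Definition transition_mx : 'M[R]_#|{: graph_arc}| :=
  reversal_mx *m (2 *: (tail_mx *m tail_mx^T) - 1%:M).

Definition walk_mx (t : nat) : 'M[R]_#|G| :=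
  tail_mx^T *m (transition_mx ^+ t) *m tail_mx.

Definition spectral_idempotent (theta : R) : 'M[R]_#|G| :=
  ortho_proj (eigenspace (walk_mx 1) theta).

(* A matrix has finitely many eigenvalues, so the finitely-supported sum below
   is the sum over all distinct eigenvalues. *)
Definition peak_state_transfer (u v : G) (t : nat) : Prop :=
  let x := enum_rank u in let y := enum_rank v in
  [/\ u != v, (0 < t)%N,
      `|walk_mx t x y| =
        \sum_(theta \in [set th | eigenvalue (walk_mx 1) th]%classic)
          `|spectral_idempotent theta x y|
    & exists2 theta, eigenvalue (walk_mx 1) theta
                     & spectral_idempotent theta x y != 0].

Definition has_peak_state_transfer : Prop :=
  exists u v t, peak_state_transfer u v t.

End ArcReversalWalk.

(* Main.v *)
Require Import Defs.
From mathcomp Require Import classical_sets boolp fsbigop reals.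
From mathcomp Require Import all_boot all_order all_algebra.
From mathcomp Require Import ring lra zify.

Set Implicit Arguments.
Unset Strict Implicit.
Unset Printing Implicit Defensive.

(** Write [N] and [U] for the tail and transition matrices and
    [B = walk_mx 1]. From [U^2 N = 2 U N B - N] the matrices [walk_mx t] satisfy
    the Chebyshev recursion ([walk_mxSS]), so [walk_mx t] is the sum of the
    [T_t(theta) E_theta] ([walk_mx_chebyshev]). Since [|T_t| <= 1] on [[-1, 1]],
    peak state transfer from [u] to [v] is equality in the triangle inequality.
    If moreover [E_1(u, v) > 0] for the eigenvalue [1], it says that [T_t(theta)]
    is the sign of [E_theta(u, v)] whenever that entry is nonzero
    ([peak_state_transferP]).

    For a strongly regular graph [B = A / k], and
    [A^2 = (a - c) A + (k - c) I + c J] makes the projections explicit: the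
    eigenvalues of [A] are [k] and the roots [s < r] of
    [x^2 - (a - c) x - (k - c)].

    - If [c = 0], then [r = k] and [s = -1], and peak state transfer means that
      [u] and [v] are adjacent and [T_t(-1/k) = -1] ([disconnected_peak]). A
      rational [x] with [T_t(x) = 1] or [-1] has [2 x] integral
      ([chebyshev_rat_half_int]), so [k] is 1 or 2, and [k = 2] fails because
      [T_t(-1/2)] is 1 or [-1/2].
    - If [c = k], then [r = 0] and [s = a - k]. The entry of [E_s] never vanishes
      off the diagonal, so [2 (a - k) / k] is an integer, that is, [a = 0] or
      [k = 2 a]. Conversely, distinct nonadjacent vertices then have peak state transfer
      at time 6.
    - If [0 < c < k], the off-diagonal entries of [E_r] and [E_s] are nonzero of
      opposite signs, so [T_t(r/k)] and [T_t(s/k)] would be 1 and [-1] in some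
      order. This is impossible ([primitive_no_chebyshev]): if [r] is irrational,
      then [r] and [s] are conjugate and the two values agree, and if [r] is
      rational, then [2 r / k] and [2 s / k] are integers, which no parameters
      of a noncomplete graph allow.

    Hence there is peak state transfer exactly when [k = 1], or [c = k] and
    [a = 0], or [c = k = 2 a] ([srg_peak_params]). When [k = 1] the components are
    copies of [K_2]; when [c = k] non-adjacency is an equivalence relation with
    classes of size [n - k], and [n + a = 2 k] shows that there are two classes
    if [a = 0] and three if [k = 2 a]. *)

(** * Chebyshev polynomials *)

Section Chebyshev.
Import Order.TTheory GRing.Theory Num.Theory.
Local Open Scope ring_scope.

(** The value at [x] of the [t]-th Chebyshev polynomial of the first kind. *)
Fixpoint chebyshev (F : pzRingType) (x : F) (t : nat) : F :=
  match t with
  | 0 => 1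
  | t1.+1 => match t1 with
             | 0 => x
             | t2.+1 => 2 * x * chebyshev x t1 - chebyshev x t2
             end
  end.

Lemma chebyshevSS (F : pzRingType) (x : F) t :
  chebyshev x t.+2 = 2 * x * chebyshev x t.+1 - chebyshev x t.
Proof. by []. Qed.

Lemma chebyshev1 (F : comPzRingType) t : chebyshev (1 : F) t = 1.
Proof.
suff: chebyshev (1 : F) t = 1 /\ chebyshev (1 : F) t.+1 = 1 by case.
by elim: t => [//|t [IH1 IH2]]; rewrite chebyshevSS IH1 IH2; split=> //; ring.
Qed.

Lemma rmorph_chebyshev (F K : pzRingType) (f : {rmorphism F -> K}) x t :
  chebyshev (f x) t = f (chebyshev x t).
Proof.
suff: chebyshev (f x) t = f (chebyshev x t)
   /\ chebyshev (f x) t.+1 = f (chebyshev x t.+1) by case.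
elim: t => [|t [IH1 IH2]]; first by rewrite rmorph1.
by split=> //; rewrite !chebyshevSS rmorphB !rmorphM rmorph_nat IH1 IH2.
Qed.

(** The sum of [(T_(t+1) - x T_t) ^ 2] and [(1 - x ^ 2) T_t ^ 2] does not depend
    on [t]. *)
Lemma chebyshev_first_integral (F : comPzRingType) (x : F) t :
  (chebyshev x t.+1 - x * chebyshev x t) ^+ 2
  = (1 - x ^+ 2) * (1 - chebyshev x t ^+ 2).
Proof.
elim: t => [|t IH]; first by rewrite /=; ring.
rewrite chebyshevSS; apply/eqP; rewrite -subr_eq0; apply/eqP.
move/eqP: IH; rewrite -subr_eq0 => /eqP IH.
by rewrite -[RHS]IH; ring.
Qed.

Lemma normr_chebyshev_le1 (F : realFieldType) (x : F) t :
  `|x| <= 1 -> `|chebyshev x t| <= 1.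
Proof.
move=> x1; have x2 : x ^+ 2 <= 1 by rewrite -real_normK ?num_real// expr_le1.
suff: chebyshev x t ^+ 2 <= 1.
  by rewrite -(real_normK (num_real (chebyshev x t))) expr_le1.
have [x2lt|] := ltP (x ^+ 2) 1.
  have := chebyshev_first_integral x t => E.
  have : 0 <= (1 - x ^+ 2) * (1 - chebyshev x t ^+ 2) by rewrite -E sqr_ge0.
  by rewrite pmulr_rge0 ?subr_gt0// subr_ge0.
move=> x2ge; have x2E : x ^+ 2 = 1 by apply/le_anti/andP.
suff: chebyshev x t ^+ 2 = 1 by move=> ->.
(* For x = 1 or x = -1 the first integral gives T_(t+1) = x T_t. *)
elim: t => [|t IH]; first by rewrite expr1n.
have := chebyshev_first_integral x t; rewrite x2E subrr mul0r => /eqP.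
by rewrite sqrf_eq0 subr_eq0 => /eqP->; rewrite exprMn x2E IH mulr1.
Qed.

(** If [2 * x = p / q] in lowest terms and [t > 0], then [q ^ t * 2 * T_t(x)] is
    an integer congruent to [p ^ t] modulo [q]. *)
Lemma chebyshev_rat_num (x : rat) t : exists m : int,
  (denq (2 * x))%:~R ^+ t.+1 * (2 * chebyshev x t.+1)
  = (numq (2 * x) ^+ t.+1 + denq (2 * x) * m)%:~R :> rat.
Proof.
set p := numq _; set q := denq _.
have xE : (q%:~R : rat) * (2 * x) = p%:~R.
  by rewrite numqE mulrC.
suff: (exists m : int, (q%:~R : rat) ^+ t.+1 * (2 * chebyshev x t.+1)
    = (p ^+ t.+1 + q * m)%:~R) /\
  (exists m : int, (q%:~R : rat) ^+ t.+2 * (2 * chebyshev x t.+2)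
    = (p ^+ t.+2 + q * m)%:~R) by case.
elim: t => [|t [[m1 IH1] [m2 IH2]]].
  split; first by exists 0; rewrite mulr0 addr0 !expr1.
  exists (- q * 2); rewrite intrD !intrM mulrNz -xE /=.
  by ring.
split; first by exists m2.
exists (p * m2 - q * (p ^+ t.+1 + q * m1)).
rewrite chebyshevSS.
transitivity ((q%:~R * (2 * x))
    * ((q%:~R : rat) ^+ t.+2 * (2 * chebyshev x t.+2))
  - q%:~R ^+ 2 * ((q%:~R : rat) ^+ t.+1 * (2 * chebyshev x t.+1))).
  by rewrite !exprS; ring.
rewrite IH1 IH2 xE expr2 -!intrM -intrB; congr (_%:~R).
by rewrite /= !exprS; ring.
Qed.

(** A form of Niven's theorem: rational cosines of angles with
    [cos (t * angle) = 1] or [-1] are halves of integers. *)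
Lemma chebyshev_rat_half_int (x : rat) t :
  chebyshev x t.+1 ^+ 2 = 1 -> 2 * x \is a Num.int.
Proof.
move=> T1; have [m] := chebyshev_rat_num x t.
set p := numq _; set q := denq _ => E.
have [e eE] : exists e : int, 2 * chebyshev x t.+1 = e%:~R.
  move/eqP: T1; rewrite sqrf_eq1 => /orP[] /eqP->.
    by exists 2; rewrite mulr1.
  by exists (-2); rewrite mulrN1 rmorphN.
have {}E : q ^+ t.+1 * e = p ^+ t.+1 + q * m.
  by apply: (@intr_inj rat); rewrite -E eE rmorphM rmorphXn.
have qp : (q %| p ^+ t.+1)%Z.
  have -> : p ^+ t.+1 = q * (q ^+ t * e - m).
    by rewrite mulrBr mulrA -exprS E addrK.
  exact: dvdz_mulr.
have cop : coprimez q (p ^+ t.+1).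
  by apply: coprimezXr; rewrite coprimez_sym; exact: coprime_num_den.
have q1 : q = 1.
  have : (q %| 1)%Z by rewrite -(Gauss_dvdzr _ cop) mulr1.
  by rewrite dvdz1 => /eqP; have := denq_gt0 (2 * x); rewrite -/q; lia.
by rewrite Qint_def; apply/eqP.
Qed.

(** Conjugate numbers have conjugate Chebyshev values. *)
Lemma chebyshev_conj (F : numFieldType) (x y : F) (p q : rat) t :
  x + y = ratr p -> x * y = ratr q ->
  exists al be : rat, chebyshev x t = ratr al + ratr be * x
                   /\ chebyshev y t = ratr al + ratr be * y.
Proof.
move=> xDy xMy.
pose P t := exists al be : rat, chebyshev x t = ratr al + ratr be * x
                   /\ chebyshev y t = ratr al + ratr be * y.
suff: P t /\ P t.+1 by case.
elim: t => [|t [IH1 IH2]].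
  split; first by exists 1, 0; rewrite !rmorph1 !rmorph0 !mul0r !addr0.
  by exists 0, 1; rewrite !rmorph1 !rmorph0 !mul1r !add0r.
split=> //; case: IH1 IH2 => [a1 [b1 [x1 y1]]] [a2 [b2 [x2 y2]]].
exists (- 2 * b2 * q - a1), (2 * (a2 + b2 * p) - b1).
have step (u : F) : u * u = ratr p * u - ratr q ->
    2 * u * (ratr a2 + ratr b2 * u) - (ratr a1 + ratr b1 * u)
    = ratr (- 2 * b2 * q - a1) + ratr (2 * (a2 + b2 * p) - b1) * u.
  move=> uE; rewrite !(rmorphB, rmorphD, rmorphM, rmorphN, rmorph_nat) /=.
  transitivity (2 * ratr a2 * u + 2 * ratr b2 * (u * u)
    - (ratr a1 + ratr b1 * u)); first by ring.
  by rewrite uE; ring.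
rewrite !chebyshevSS x1 x2 y1 y2.
by split; apply: step; rewrite -xDy -xMy; ring.
Qed.

Lemma chebyshev_irrational_conj (F : numFieldType) (x y : F) (p q e : rat) t :
  x + y = ratr p -> x * y = ratr q -> (forall z : rat, x <> ratr z) ->
  chebyshev x t = ratr e -> chebyshev y t = ratr e.
Proof.
move=> xDy xMy irr; have [al [be [-> ->]]] := chebyshev_conj t xDy xMy.
have [->|be0] := eqVneq be 0; first by rewrite rmorph0 !mul0r.
move=> E; case: (irr ((e - al) / be)).
rewrite fmorph_div rmorphB /= -E addrC addKr mulrC mulKf//.
by rewrite fmorph_eq0.
Qed.

(** [-1/2] is the cosine of a third of a turn, so [T_t(-1/2)] has period three,
    with values [1], [-1/2], [-1/2]. *)
Lemma chebyshev_neg_half (F : numFieldType) t :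
  chebyshev (- 2^-1 : F) t <> -1.
Proof.
pose P (u v : F) := [\/ u = 1 /\ v = - 2^-1 :> F, u = - 2^-1 /\ v = - 2^-1 :> F
  | u = - 2^-1 /\ v = 1 :> F].
have : P (chebyshev (- 2^-1 : F) t) (chebyshev (- 2^-1 : F) t.+1).
  elim: t => [|t]; first by apply: Or31.
  rewrite chebyshevSS => -[] [-> ->].
  - by apply: Or32; split=> //; field.
  - by apply: Or33; split=> //; field.
  - by apply: Or31; split=> //; field.
have h : (-2^-1 : F) = -1 -> False.
  move=> /eqP; rewrite eqr_opp invr_eq1 => /eqP h.
  by have := @pnatr_eq1 F 2; rewrite h eqxx.
have h1 : (1 : F) = -1 -> False.
  by move=> /eqP; rewrite -subr_eq0 opprK -mulr2n pnatr_eq0.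
by case=> -[-> _]; [exact: h1|exact: h|exact: h].
Qed.

End Chebyshev.

(** * Spectral decompositions of symmetric matrices *)

Section SpectralDecomposition.
Import Order.TTheory GRing.Theory Num.Theory.
Local Open Scope ring_scope.

(** [ortho_proj] of the row space of a symmetric idempotent is that
    idempotent. *)
Lemma ortho_proj_idem (R : realType) n (W F : 'M[R]_n) :
  F^T = F -> F *m F = F -> (W == F)%MS -> ortho_proj W = F.
Proof.
move=> symF idF /andP[WF FW].
have WK : W *m F = W.
  by case/submxP: WF => D ->; rewrite -mulmxA idF.
have WTK : F *m W^T = W^T by rewrite -{1}symF -trmx_mul WK.
have dx : (W :&: kermx W^T = 0)%MS.
  set U := (W :&: _)%MS.
  have UK : U *m F = U.
    have /submxP[D ->] : (U <= W)%MS by apply: capmxSl.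
    by rewrite -mulmxA WK.
  have /sub_kermxP UW : (U <= kermx W^T)%MS by apply: capmxSr.
  have /submxP[D FE] := FW.
  by rewrite -UK -symF FE trmx_mul mulmxA UW mul0mx.
rewrite /ortho_proj -[proj_mx _ _]mul1mx -[1%:M](addrNK F) mulmxDl.
rewrite (proj_mx_id dx FW) proj_mx_0 ?add0r//.
by apply/sub_kermxP; rewrite mulmxBl mul1mx WTK subrr.
Qed.

Variables (R : realType) (n m : nat) (B : 'M[R]_n).
Variables (th : 'I_m -> R) (F : 'I_m -> 'M[R]_n).

(** [B] acts as [th i] on the row space of the symmetric [F i], and the [F i]
    add up to the identity. When the [th i] are distinct this forces the [F i]
    to be the orthogonal projections onto the eigenspaces of [B]. *)
Definition spectral_decomposition :=
  [/\ injective th, forall i, (F i)^T = F i,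
      forall i, F i *m B = th i *: F i & \sum_i F i = 1%:M].

Hypothesis symB : B^T = B.
Hypothesis decB : spectral_decomposition.

Lemma spectral_mulmx i j :
  F i *m F j = if i == j then F i else 0.
Proof.
case: decB => inj_th symF FB sumF.
have orth k l : k != l -> F k *m F l = 0.
  move=> kl; have BF : B *m F l = th l *: F l.
    by rewrite -(symF l) -{1}symB -trmx_mul FB linearZ.
  have : (th k - th l) *: (F k *m F l) = 0.
    by rewrite scalerBl scalemxAl -FB scalemxAr -BF mulmxA subrr.
  move/eqP; rewrite scaler_eq0 subr_eq0 => /orP[/eqP/inj_th/eqP|/eqP//].
  by rewrite (negPf kl).
case: eqVneq => [<-{j}|]; last exact: orth.
rewrite -[RHS]mulmx1 -sumF mulmx_sumr (bigD1 i)//= big1 ?addr0// => j ji.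
by rewrite orth// eq_sym.
Qed.

Lemma ortho_proj_eigenspace i : ortho_proj (eigenspace B (th i)) = F i.
Proof.
case: (decB) => inj_th symF FB sumF.
apply: ortho_proj_idem; rewrite ?spectral_mulmx ?eqxx//.
apply/andP; split; last exact/eigenspaceP.
set W := eigenspace _ _.
have WB : W *m B = th i *: W by apply/eigenspaceP.
have W0 j : j != i -> W *m F j = 0.
  move=> ji; have BF : B *m F j = th j *: F j.
    by rewrite -(symF j) -{1}symB -trmx_mul FB linearZ.
  have : (th i - th j) *: (W *m F j) = 0.
    by rewrite scalerBl scalemxAl -WB scalemxAr -BF mulmxA subrr.
  move/eqP; rewrite scaler_eq0 subr_eq0 => /orP[/eqP/inj_th/eqP|/eqP//].
  by rewrite eq_sym (negPf ji).
apply/submxP; exists W.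
by rewrite -[LHS]mulmx1 -sumF mulmx_sumr (bigD1 i)//= big1 ?addr0.
Qed.

Lemma eigenvalue_spectral x : eigenvalue B x -> exists i, x = th i.
Proof.
case: (decB) => inj_th symF FB sumF /eigenvalueP[v vB v0].
have [i Fi0|F0] := pickP (fun i => v *m F i != 0).
  exists i; apply/eqP; move: Fi0; apply: contraNT => xi.
  have BF : B *m F i = th i *: F i.
    by rewrite -(symF i) -{1}symB -trmx_mul FB linearZ.
  have : (x - th i) *: (v *m F i) = 0.
    by rewrite scalerBl scalemxAl -vB scalemxAr -BF mulmxA subrr.
  by move/eqP; rewrite scaler_eq0 subr_eq0 (negPf xi).
case/eqP: v0; rewrite -[v]mulmx1 -sumF mulmx_sumr big1// => i _.
by have /negbFE/eqP := F0 i.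
Qed.

Lemma spectral_eigenvalue i : F i != 0 -> eigenvalue B (th i).
Proof.
case: (decB) => inj_th symF FB sumF.
case/rowV0Pn => v /submxP[D vE] v0; apply/eigenvalueP; exists v => //.
by rewrite vE -mulmxA FB scalemxAr.
Qed.

Lemma spectral_fsum (f : 'M[R]_n -> R) : f 0 = 0 ->
  \sum_(x \in [set x | eigenvalue B x]%classic)
      f (ortho_proj (eigenspace B x)) = \sum_i f (F i).
Proof.
move=> f0; have [inj_th _ _ _] := decB.
rewrite (@fsbig_fwiden _ _ _ _ [seq th i | i : 'I_m]).
- rewrite big_map big_enum; apply: eq_bigr => i _.
  by rewrite ortho_proj_eigenspace.
- move=> x /= /eigenvalue_spectral[i ->].
  by apply: map_f; rewrite mem_enum.
- by rewrite map_inj_uniq ?enum_uniq.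
move=> x [] /= /mapP[i _ ->] NE; rewrite ortho_proj_eigenspace.
by have [->//|/spectral_eigenvalue] := eqVneq (F i) 0.
Qed.

End SpectralDecomposition.

(** * The arc-reversal walk *)

Section Walk.
Import Order.TTheory GRing.Theory Num.Theory.
Local Open Scope ring_scope.
Variables (R : realType) (G : sgraph).

Lemma arc_at_inj : injective (@arc_at G).
Proof. by move=> e e' /val_inj/enum_val_inj. Qed.

Lemma arc_at_rev (e : 'I_#|{: graph_arc G}|) :
  exists e', arc_at e' = ((arc_at e).2, (arc_at e).1).
Proof.
pose q := ((arc_at e).2, (arc_at e).1).
have aq : adj q.1 q.2 by rewrite /= adj_sym; apply: (valP (enum_val e)).
by exists (enum_rank (Sub q aq : graph_arc G)); rewrite {1}/arc_at enum_rankK.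
Qed.

Lemma sum_arcs (f : G * G -> R) :
  \sum_(i < #|{: graph_arc G}|) f (arc_at i)
  = \sum_(u : G) \sum_(v | adj u v) f (u, v).
Proof.
rewrite /arc_at.
rewrite -(big_enum_val (fun p : graph_arc G => f (val p))) /=.
rewrite -(big_sub [pred p : G * G | adj p.1 p.2] f) /=.
rewrite pair_big_dep /=; apply: eq_big => [[u v]|[u v]] //.
Qed.

Hypothesis no_isolated : forall u : G, (0 < deg u)%N.

Lemma tail_mx_isometry : (tail_mx R G)^T *m tail_mx R G = 1%:M.
Proof.
apply/matrixP => i j; rewrite !mxE.
pose g (p : G * G) : R :=
  (if p.1 == enum_val i then (Num.sqrt (deg (enum_val i))%:R)^-1 else 0) *
  (if p.1 == enum_val j then (Num.sqrt (deg (enum_val j))%:R)^-1 else 0).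
transitivity (\sum_(e < #|{: graph_arc G}|) g (arc_at e)).
  by apply: eq_bigr => e _; rewrite !mxE.
rewrite sum_arcs (bigD1 (enum_val i)) //= [X in _ + X]big1 ?addr0; last first.
  by move=> u ui; rewrite big1// => v _; rewrite /g /= (negPf ui) mul0r.
rewrite /g /= eqxx (inj_eq enum_val_inj).
case: eqVneq => [<-|ij]; last by rewrite big1// => v _; rewrite mulr0.
rewrite sumr_const -invfM -expr2 sqr_sqrtr ?ler0n//.
rewrite (_ : #|_| = deg (enum_val i)); last by rewrite /deg cardsE.
by rewrite -[LHS]mulr_natr mulVf// pnatr_eq0 -lt0n no_isolated.
Qed.

Lemma reversal_mx_invol : reversal_mx R G *m reversal_mx R G = 1%:M.
Proof.
apply/matrixP => i j; rewrite !mxE.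
have [i' i'E] := arc_at_rev i.
rewrite (bigD1 i')//= big1 ?addr0.
  rewrite !mxE i'E eqxx mul1r /= -surjective_pairing.
  by rewrite (inj_eq arc_at_inj) eq_sym.
by move=> e ei; rewrite !mxE -i'E (inj_eq arc_at_inj) (negPf ei) mul0r.
Qed.

Lemma transition_tail : transition_mx R G *m tail_mx R G
  = reversal_mx R G *m tail_mx R G.
Proof.
rewrite /transition_mx -mulmxA mulmxBl -scalemxAl -mulmxA tail_mx_isometry.
by rewrite mulmx1 mul1mx scaler_nat mulr2n addrK.
Qed.

Lemma walk_mx0 : walk_mx R G 0 = 1%:M.
Proof. by rewrite /walk_mx expr0 mulmx1 tail_mx_isometry. Qed.

Lemma walk_mx1E : walk_mx R G 1
  = (tail_mx R G)^T *m reversal_mx R G *m tail_mx R G.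
Proof. by rewrite /walk_mx expr1 -mulmxA transition_tail mulmxA. Qed.

Lemma walk_mx1_entry u v : walk_mx R G 1 (enum_rank u) (enum_rank v)
  = (adj u v)%:R / (Num.sqrt (deg u)%:R * Num.sqrt (deg v)%:R).
Proof.
rewrite walk_mx1E -mulmxA !mxE.
set du := Num.sqrt (deg u)%:R; set dv := Num.sqrt (deg v)%:R.
pose g (p : G * G) : R := (if p.1 == u then du^-1 else 0) *
  (if p.2 == v then dv^-1 else 0).
transitivity (\sum_(e < #|{: graph_arc G}|) g (arc_at e)).
  apply: eq_bigr => e _; rewrite !mxE enum_rankK; congr (_ * _).
  have [e' e'E] := arc_at_rev e.
  rewrite (bigD1 e')//= big1 ?addr0.
    by rewrite !mxE e'E eqxx mul1r enum_rankK.
  by move=> f fe; rewrite !mxE -e'E (inj_eq arc_at_inj) (negPf fe) mul0r.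
rewrite sum_arcs (bigD1 u) //= [X in _ + X]big1 ?addr0; last first.
  by move=> w wu; rewrite big1// => x _; rewrite /g /= (negPf wu) mul0r.
rewrite big_mkcond (bigD1 v) //= [X in _ + X]big1 ?addr0; last first.
  by move=> w wv; rewrite /g /= (negPf wv) mulr0 if_same.
by rewrite /g /= !eqxx invfM; case: adj; rewrite ?mul1r ?mul0r.
Qed.

Lemma trmx_walk_mx1 : (walk_mx R G 1)^T = walk_mx R G 1.
Proof.
apply/matrixP => i j; rewrite mxE -[i]enum_valK -[j]enum_valK.
by rewrite !walk_mx1_entry adj_sym [X in _ / X]mulrC.
Qed.

(** The walk satisfies the Chebyshev recursion, since
    [U^2 N = 2 U N B - N] for the transition matrix [U] and tail matrix [N]. *)
Lemma walk_mxSS t : walk_mx R G t.+2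
  = 2 *: (walk_mx R G t.+1 *m walk_mx R G 1) - walk_mx R G t.
Proof.
have UUN : transition_mx R G *m (transition_mx R G *m tail_mx R G)
    = 2 *: (transition_mx R G *m tail_mx R G *m walk_mx R G 1) - tail_mx R G.
  rewrite transition_tail {1}/transition_mx -mulmxA mulmxBl mulmxBr mul1mx.
  rewrite [X in _ - X]mulmxA reversal_mx_invol mul1mx; congr (_ - _).
  rewrite -scalemxAl -scalemxAr walk_mx1E; congr (_ *: _).
  by rewrite !mulmxA.
move: UUN; move: (walk_mx R G 1) => W; rewrite /walk_mx.
move: (transition_mx R G) => U UUN.
have powS l : U ^+ l.+1 = U ^+ l *m U by rewrite exprSr.
move: (GRing.exp U) powS => P powS.
by rewrite !powS -!mulmxA UUN !mulmxBr -!scalemxAr !mulmxA.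
Qed.

Section Decomposed.
Variables (m : nat) (th : 'I_m -> R) (F : 'I_m -> 'M[R]_#|G|).
Hypothesis decB : spectral_decomposition (walk_mx R G 1) th F.

Lemma walk_mx_chebyshev t :
  walk_mx R G t = \sum_i chebyshev (th i) t *: F i.
Proof.
have [_ _ FB sumF] := decB.
pose P t := walk_mx R G t = \sum_i chebyshev (th i) t *: F i.
suff: P t /\ P t.+1 by case.
elim: t => [|t [IH1 IH2]].
  rewrite /P walk_mx0 -sumF; split.
    by apply: eq_bigr => i _; rewrite scale1r.
  rewrite -[LHS]mul1mx -sumF mulmx_suml.
  by apply: eq_bigr => i _; rewrite FB.
split=> //; rewrite /P walk_mxSS IH1 IH2 mulmx_suml scaler_sumr -sumrB.
apply: eq_bigr => i _.
rewrite -scalemxAl FB !scalerA chebyshevSS scalerBl.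
by congr (_ *: _ - _); ring.
Qed.

(** Some eigenvalue is [1] with a positive entry, so equality in the triangle
    inequality forces every term to be nonnegative, and hence every
    [T_t(th i)] with nonzero entry to be the sign of that entry. *)
Lemma peak_state_transferP (u v : G) t (i0 : 'I_m) :
  (forall i, `|th i| <= 1) -> th i0 = 1 ->
  0 < F i0 (enum_rank u) (enum_rank v) ->
  peak_state_transfer R u v t <->
  [/\ u != v, (0 < t)%N & forall i,
     chebyshev (th i) t * F i (enum_rank u) (enum_rank v)
     = `|F i (enum_rank u) (enum_rank v)| ].
Proof.
move=> th1 thi0 Fi0; set x := enum_rank u; set y := enum_rank v.
have symB := trmx_walk_mx1.
have sumE : \sum_(theta \in [set th0 | eigenvalue (walk_mx R G 1) th0]%classic)
          `|spectral_idempotent G theta x y| = \sum_i `|F i x y|.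
  rewrite -(spectral_fsum symB decB (f := fun M => `|M x y|))//.
  by rewrite mxE normr0.
have walkE : walk_mx R G t x y = \sum_i chebyshev (th i) t * F i x y.
  by rewrite walk_mx_chebyshev summxE; apply: eq_bigr => i _; rewrite mxE.
have bound i : `|chebyshev (th i) t * F i x y| <= `|F i x y|.
  by rewrite normrM ler_piMl// normr_chebyshev_le1.
split=> [[uv t0 peak _]|[uv t0 eqF]]; last first.
  split=> //; first rewrite sumE walkE.
    by rewrite (eq_bigr _ (fun i _ => eqF i)) ger0_norm// sumr_ge0.
  exists (th i0); last first.
    by rewrite /spectral_idempotent (ortho_proj_eigenspace symB decB) gt_eqF.
  apply: (spectral_eigenvalue decB); apply: contraTneq Fi0 => ->.
  by rewrite mxE ltxx.
split=> // i; move: peak; rewrite sumE walkE.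
have [S0|S0] := leP 0 (\sum_i chebyshev (th i) t * F i x y).
  rewrite ger0_norm// => peak.
  have /eqP : \sum_i (`|F i x y| - chebyshev (th i) t * F i x y) = 0.
    by rewrite sumrB peak subrr.
  rewrite psumr_eq0 => [/allP/(_ i)|j _]; last first.
    by rewrite subr_ge0 (le_trans (ler_norm _)).
  by rewrite mem_index_enum subr_eq0 => /(_ isT)/eqP.
rewrite ltr0_norm// => peak.
have /eqP : \sum_i (`|F i x y| + chebyshev (th i) t * F i x y) = 0.
  by rewrite big_split /= -peak addNr.
rewrite psumr_eq0 => [/allP/(_ i0)|j _]; last first.
  rewrite -[chebyshev _ _ * _]opprK subr_ge0.
  by rewrite (le_trans (ler_norm _))// normrN.
rewrite mem_index_enum thi0 chebyshev1 mul1r gtr0_norm// => /(_ isT).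
by rewrite gt_eqF// addr_gt0.
Qed.

End Decomposed.
End Walk.

(** * Strongly regular graphs *)

Section StronglyRegular.
Import Order.TTheory GRing.Theory Num.Theory.
Local Open Scope ring_scope.
Variables (G : sgraph) (n k a c : nat).
Hypothesis Gsr : strongly_regular G n k a c.

Lemma srg_edge : exists u v : G, adj u v.
Proof.
case: Gsr => _ _ ne _ _.
have [[u v] /= uv|no] := pickP (fun p : G * G => adj p.1 p.2).
  by exists u, v.
by case: ne => u v; rewrite (no (u, v)).
Qed.

Lemma srg_nonedge : exists u v : G, u != v /\ ~~ adj u v.
Proof.
case: Gsr => _ nc _ _ _.
have [[u v] /= /andP[uv nuv]|no] :=
    pickP (fun p : G * G => (p.1 != p.2) && ~~ adj p.1 p.2).
  by exists u, v.
by case: nc => u v uv; have := no (u, v); rewrite /= uv => /negbFE.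
Qed.

Lemma srg_degree_gt0 : (0 < k)%N.
Proof.
case: Gsr => _ _ _ dk _; have [u [v uv]] := srg_edge.
by rewrite -(dk u) card_gt0; apply/set0Pn; exists v; rewrite inE.
Qed.

Lemma srg_no_isolated (u : G) : (0 < deg u)%N.
Proof. by case: Gsr => _ _ _ -> _; exact: srg_degree_gt0. Qed.

Lemma srg_adj_lt_degree : (a < k)%N.
Proof.
case: Gsr => _ _ _ dk com; have [u [v uv]] := srg_edge.
have uNv : u != v by apply: contraTneq uv => ->; rewrite adj_irr.
rewrite -(dk u); have := com u v uNv; rewrite uv => <-.
rewrite /common_nbrs /deg; apply: proper_card; apply/properP; split.
  by apply/subsetP => w; rewrite !inE => /andP[].
by exists v; rewrite !inE ?uv// adj_irr andbF.
Qed.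

Lemma srg_nonadj_le_degree : (c <= k)%N.
Proof.
case: Gsr => _ _ _ dk com; have [u [v [uNv /negPf uv]]] := srg_nonedge.
rewrite -(dk u); have := com u v uNv; rewrite uv => <-.
rewrite /common_nbrs /deg; apply: subset_leq_card; apply/subsetP => w.
by rewrite !inE => /andP[].
Qed.

Lemma srg_degree_lt_order : (k.+1 < n)%N.
Proof.
case: Gsr => nG _ _ dk _; have [u [v [uNv /negPf uv]]] := srg_nonedge.
rewrite -(dk u) -nG -cardsT.
have -> : (deg u).+1 = #|u |: [set w | adj u w]|.
  by rewrite cardsU1 inE adj_irr add1n.
apply: proper_card; apply/properP; split; first exact: subsetT.
by exists v; rewrite !inE// uv orbF eq_sym.
Qed.

Variable R : realType.

(** The adjacency matrix, with the vertices numbered as in the walk. *)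
Definition adj_mx : 'M[R]_#|G| :=
  \matrix_(i, j) (adj (enum_val i) (enum_val j))%:R.

Local Notation A := adj_mx.
Local Notation J := (const_mx 1 : 'M[R]_#|G|).

Lemma trmx_adj_mx : A^T = A.
Proof. by apply/matrixP => i j; rewrite !mxE adj_sym. Qed.

Lemma walk_mx1_adj : walk_mx R G 1 = k%:R^-1 *: A.
Proof.
apply/matrixP => i j; rewrite -[i]enum_valK -[j]enum_valK.
rewrite (walk_mx1_entry _ srg_no_isolated) !mxE !enum_rankK.
by case: Gsr => _ _ _ dk _; rewrite !dk -expr2 sqr_sqrtr ?ler0n// mulrC.
Qed.

Lemma sum_adj (u v : G) :
  \sum_(w : G) (adj u w)%:R * (adj w v)%:R = (common_nbrs u v)%:R :> R.
Proof.
rewrite /common_nbrs -sum1_card natr_sum [RHS]big_mkcond /=.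
apply: eq_bigr => w _; rewrite inE (adj_sym v).
by case: adj; case: adj; rewrite ?mul0r ?mul1r.
Qed.

Lemma adj_mx_sqr : A *m A = (a%:R - c%:R) *: A + (k%:R - c%:R)%:M + c%:R *: J.
Proof.
case: Gsr => _ _ _ dk com; apply/matrixP => i j; rewrite !mxE.
pose f (w : G) : R := (adj (enum_val i) w)%:R * (adj w (enum_val j))%:R.
transitivity (\sum_(e < #|G|) f (enum_val e)).
  by apply: eq_bigr => e _; rewrite !mxE.
rewrite -(big_enum_val f) /= sum_adj.
have [<-|ij] := eqVneq i j.
  rewrite adj_irr /common_nbrs (_ : #|_| = deg (enum_val i)); last first.
    by apply: eq_card => w; rewrite !inE andbb.
  by rewrite dk /=; ring.
rewrite com ?(inj_eq enum_val_inj)//.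
by case: adj; rewrite /=; ring.
Qed.

Lemma adj_mx_ones : A *m J = k%:R *: J.
Proof.
case: Gsr => _ _ _ dk _; apply/matrixP => i j; rewrite !mxE.
transitivity (\sum_(e < #|G|) (adj (enum_val i) (enum_val e))%:R : R).
  by apply: eq_bigr => e _; rewrite !mxE mulr1.
rewrite -(big_enum_val (fun w => (adj (enum_val i) w)%:R : R)) /=.
rewrite -(dk (enum_val i)) /deg -sum1_card natr_sum mulr1 [RHS]big_mkcond /=.
by apply: eq_bigr => w _; rewrite inE; case: adj.
Qed.

Lemma ones_adj_mx : J *m A = k%:R *: J.
Proof.
rewrite -[LHS]trmxK trmx_mul trmx_adj_mx trmx_const adj_mx_ones.
by rewrite linearZ /= trmx_const.
Qed.

Lemma ones_mx_sqr : J *m J = n%:R *: J.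
Proof.
case: Gsr => nG _ _ _ _; apply/matrixP => i j; rewrite !mxE.
under eq_bigr do rewrite !mxE mulr1.
by rewrite sumr_const card_ord nG mulr1.
Qed.

(** Walks of length two from a vertex, counted through [A^2]. *)
Lemma srg_count :
  n%:R * c%:R = k%:R ^+ 2 - (a%:R - c%:R) * k%:R - (k%:R - c%:R) :> R.
Proof.
have [u _] := srg_edge; pose i := enum_rank u.
have := congr1 (fun M => (M *m J) i i) adj_mx_sqr.
rewrite -mulmxA adj_mx_ones -scalemxAr adj_mx_ones !mulmxDl -!scalemxAl.
rewrite adj_mx_ones ones_mx_sqr mul_scalar_mx !mxE !mulr1 => E.
by rewrite expr2 E; ring.
Qed.

Lemma srg_count_nat : (n * c + a * k + k = k * k + c * k + c)%N.
Proof.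
have E := srg_count; apply/eqP; rewrite -(eqr_nat R).
by rewrite !natrD !natrM E; apply/eqP; ring.
Qed.

End StronglyRegular.

(** * Peak state transfer in a strongly regular graph *)

Section Peak.
Import Order.TTheory GRing.Theory Num.Theory.
Local Open Scope ring_scope.
Variables (R : realType) (G : sgraph) (n k a c : nat).
Hypothesis Gsr : strongly_regular G n k a c.

Local Notation A := (adj_mx G R).
Local Notation J := (const_mx 1 : 'M[R]_#|G|).
Local Notation N := (n%:R : R).
Local Notation K := (k%:R : R).
Local Notation Aa := (a%:R : R).
Local Notation Cc := (c%:R : R).

Let K_gt0 : 0 < K. Proof. by rewrite ltr0n (srg_degree_gt0 Gsr). Qed.

Let K_neq0 : K != 0. Proof. by rewrite gt_eqF. Qed.

Let N_gt_K1 : K + 1 < N.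
Proof. by rewrite natr1 ltr_nat (srg_degree_lt_order Gsr). Qed.

Let N_gt0 : 0 < N.
Proof. by have ? := K_gt0; have ? := N_gt_K1; lra. Qed.

Let Cc_le : Cc <= K.
Proof. by rewrite ler_nat (srg_nonadj_le_degree Gsr). Qed.

Let Aa_ge0 : 0 <= Aa. Proof. exact: ler0n. Qed.

Let NCc : N * Cc = K ^+ 2 - (Aa - Cc) * K - (K - Cc).
Proof. exact: srg_count Gsr R. Qed.

Let adj_eigen (F : 'M[R]_#|G|) x :
  F *m A = x *: F -> F *m walk_mx R G 1 = (x / K) *: F.
Proof.
by move=> FA; rewrite (walk_mx1_adj Gsr) -scalemxAr FA scalerA mulrC.
Qed.

Section Disconnected.
Hypothesis c0 : c = 0%N.

Let aE : Aa = K - 1.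
Proof.
have := NCc; rewrite c0 mulr0 !subr0 => /esym/eqP.
have -> : K ^+ 2 - Aa * K - K = K * (K - 1 - Aa) by ring.
by rewrite mulf_eq0 (negPf K_neq0) subr_eq0 /= => /eqP.
Qed.

(** The projections onto the eigenspaces of [A] for [k] and [-1]. *)
Let projK : 'M[R]_#|G| := (K + 1)^-1 *: (A + 1%:M).
Let proj1 : 'M[R]_#|G| := (K + 1)^-1 *: (K%:M - A).

Lemma disconnected_decomposition :
  spectral_decomposition (walk_mx R G 1)
    (fun i : 'I_2 => [:: 1; - K^-1]`_i)
    (fun i : 'I_2 => [:: projK; proj1]`_i).
Proof.
have K1 : K + 1 != 0 by rewrite gt_eqF// addr_gt0.
have AA : A *m A = (K - 1) *: A + K%:M.
  by rewrite (adj_mx_sqr Gsr) aE c0 !subr0 scale0r addr0.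
split.
- move=> i j; have u : uniq [:: 1; - K^-1 : R].
    by rewrite /= inE andbT gt_eqF// (lt_trans _ ltr01)// oppr_lt0 invr_gt0.
  move=> E; apply/val_inj/eqP.
  by rewrite -(nth_uniq 0 _ _ u) ?E//=; apply: ltn_ord.
- case=> [[|[|//]] ?] /=; rewrite linearZ /=; congr (_ *: _).
  + by rewrite linearD /= trmx_adj_mx tr_scalar_mx.
  + by rewrite linearB /= trmx_adj_mx tr_scalar_mx.
- case=> [[|[|//]] ?] /=.
    rewrite -[X in X *: _](divff K_neq0); apply: adj_eigen.
    rewrite -scalemxAl mulmxDl mul1mx AA [RHS]scalerA mulrC -scalerA.
    congr (_ *: _); apply/matrixP => i j; rewrite !mxE; ring.
  rewrite -mulN1r; apply: adj_eigen.
  rewrite -scalemxAl mulmxBl mul_scalar_mx AA [RHS]scalerA mulrC -scalerA.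
  by congr (_ *: _); apply/matrixP => i j; rewrite !mxE; ring.
rewrite !big_ord_recl big_ord0 /= addr0 -scalerDr.
apply/matrixP => i j; rewrite !mxE.
by case: (i == j); rewrite /=; field.
Qed.

Let projK_entry (u v : G) : u != v ->
  projK (enum_rank u) (enum_rank v) = (adj u v)%:R / (K + 1).
Proof.
move=> uv; rewrite !mxE !enum_rankK (inj_eq enum_rank_inj) (negPf uv) addr0.
by rewrite mulrC.
Qed.

Let proj1_entry (u v : G) : u != v ->
  proj1 (enum_rank u) (enum_rank v) = - ((adj u v)%:R / (K + 1)).
Proof.
move=> uv; rewrite !mxE !enum_rankK (inj_eq enum_rank_inj) (negPf uv) sub0r.
by rewrite mulrN mulrC.
Qed.

Lemma disconnected_peak (u v : G) t : peak_state_transfer R u v t <->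
  [/\ adj u v, (0 < t)%N & chebyshev (- K^-1) t = -1].
Proof.
have K1 : 0 < K + 1 by rewrite addr_gt0.
have symB := trmx_walk_mx1 R (srg_no_isolated Gsr).
have [uv|nuv] := boolP (adj u v); last first.
  split=> [|[]//]; case=> uv _ _ [x xE]; rewrite /spectral_idempotent.
  have [i ->] := eigenvalue_spectral symB disconnected_decomposition xE.
  rewrite (ortho_proj_eigenspace symB disconnected_decomposition).
  case: i => [[|[|//]] ?] /=.
    by rewrite projK_entry// (negPf nuv) mul0r eqxx.
  by rewrite proj1_entry// (negPf nuv) mul0r oppr0 eqxx.
have uNv : u != v by apply: contraTneq uv => ->; rewrite adj_irr.
have := peak_state_transferP (srg_no_isolated Gsr) disconnected_decomposition
  t (i0 := ord0) (u := u) (v := v) => /= peakP.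
rewrite peakP ?projK_entry// ?uv ?divr_gt0//; last first.
  case=> [[|[|//]] ?] /=; first by rewrite normr1.
  by rewrite normrN gtr0_norm ?invr_gt0// invf_le1// ler1n (srg_degree_gt0 Gsr).
split=> [[_ t0 eqF]|[_ t0 tE]]; split=> //.
  have := eqF (lift ord0 ord0); rewrite /= proj1_entry// uv normrN.
  rewrite gtr0_norm ?divr_gt0// mulrN -mulNr => E.
  apply: oppr_inj; rewrite opprK; apply: (mulIf (x := 1 / (K + 1))).
    by rewrite mul1r invr_neq0// gt_eqF.
  by rewrite E [RHS]mul1r.
case=> [[|[|//]] ?] /=.
  by rewrite projK_entry// uv chebyshev1 mul1r gtr0_norm ?divr_gt0.
by rewrite proj1_entry// uv tE mulN1r normrN opprK gtr0_norm ?divr_gt0.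
Qed.

End Disconnected.

Section Connected.
Hypothesis c_gt0 : (0 < c)%N.
(** [r] and [s] are the eigenvalues of [A] other than [k]. *)
Variables r s : R.
Hypotheses (rDs : r + s = Aa - Cc) (rMs : r * s = Cc - K) (s_lt_r : s < r).

Lemma srg_eigen_le0 : s <= 0.
Proof.
rewrite leNgt; apply/negP => s0.
have : 0 < r * s by rewrite mulr_gt0// (lt_trans s0).
by rewrite rMs subr_gt0 ltNge Cc_le.
Qed.

Lemma srg_eigen_ge0 : 0 <= r.
Proof.
rewrite leNgt; apply/negP => r0.
have : 0 < r * s by rewrite nmulr_rgt0// (lt_trans s_lt_r).
by rewrite rMs subr_gt0 ltNge Cc_le.
Qed.

Let NCcE : N * Cc = (K - r) * (K - s).
Proof.
transitivity (K ^+ 2 - (r + s) * K + r * s); last by ring.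
by rewrite NCc rDs rMs; ring.
Qed.

Lemma srg_eigen_lt : r < K.
Proof.
have Ks : 0 < K - s by have ? := srg_eigen_le0; have ? := K_gt0; lra.
have : 0 < (K - r) * (K - s) by rewrite -NCcE mulr_gt0 ?N_gt0 ?ltr0n.
by rewrite pmulr_lgt0// subr_gt0.
Qed.

Lemma srg_eigen_ge : - K <= s.
Proof.
have Kr : 0 < K + r by have ? := srg_eigen_ge0; have ? := K_gt0; lra.
have E : (K + r) * (K + s) = (K - 1) * (K - Cc) + Aa * K.
  transitivity (K ^+ 2 + (r + s) * K + r * s); first by ring.
  by rewrite rDs rMs; ring.
have : 0 <= (K + r) * (K + s).
  rewrite E; apply: addr_ge0; apply: mulr_ge0 => //; rewrite ?subr_ge0//.
  by rewrite ler1n (srg_degree_gt0 Gsr).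
by rewrite pmulr_rge0// => ?; lra.
Qed.

Let N_neq0 : N != 0. Proof. by rewrite gt_eqF. Qed.
Let rs_neq0 : r - s != 0. Proof. by rewrite gt_eqF// subr_gt0. Qed.

(** The projections onto the eigenspaces of [A] for [k], [r] and [s]. *)
Let proj1 : 'M[R]_#|G| := N^-1 *: J.
Let projr : 'M[R]_#|G| :=
  (r - s)^-1 *: (A - s%:M - ((K - s) / N) *: J).
Let projs : 'M[R]_#|G| :=
  (r - s)^-1 *: (((K - r) / N) *: J + r%:M - A).

Lemma connected_decomposition :
  spectral_decomposition (walk_mx R G 1)
    (fun i : 'I_3 => [:: 1; r / K; s / K]`_i)
    (fun i : 'I_3 => [:: proj1; projr; projs]`_i).
Proof.
have AA : A *m A = (r + s) *: A - (r * s)%:M + Cc *: J.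
  rewrite (adj_mx_sqr Gsr) rDs rMs.
  by apply/matrixP => i j; rewrite !mxE; case: (i == j); rewrite /=; ring.
have JA : J *m A = K *: J by exact: ones_adj_mx Gsr R.
have CE : Cc = (K - r) * (K - s) / N by rewrite -NCcE mulrC mulKf.
split.
- move=> i j; have u : uniq [:: 1; r / K; s / K].
    have r1 : r / K < 1 by rewrite ltr_pdivrMr// mul1r srg_eigen_lt.
    have s1 : s / K < r / K by rewrite ltr_pM2r// invr_gt0.
    by rewrite /= !inE !gt_eqF// (lt_trans s1).
  move=> E; apply/val_inj/eqP.
  by rewrite -(nth_uniq 0 _ _ u) ?E//=; apply: ltn_ord.
- case=> [[|[|[|//]]] ?] /=.
  + by rewrite linearZ /= trmx_const.
  + rewrite linearZ !linearB linearZ /=.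
    by rewrite trmx_adj_mx tr_scalar_mx trmx_const.
  + rewrite linearZ linearB linearD linearZ /=.
    by rewrite trmx_adj_mx tr_scalar_mx trmx_const.
- case=> [[|[|[|//]]] ?] /=.
  + rewrite -[X in X *: _](divff K_neq0); apply: adj_eigen.
    by rewrite -scalemxAl JA !scalerA mulrC.
  + apply: adj_eigen; rewrite -scalemxAl !mulmxBl mul_scalar_mx AA.
    rewrite -scalemxAl JA [RHS]scalerA [r * (r - s)^-1]mulrC.
    rewrite -[RHS]scalerA; congr (_ *: _); rewrite CE.
    apply/matrixP => i j; rewrite !mxE.
    by case: (i == j); rewrite /=; field.
  + apply: adj_eigen; rewrite -scalemxAl mulmxBl mulmxDl mul_scalar_mx AA.
    rewrite -scalemxAl JA [RHS]scalerA [s * (r - s)^-1]mulrC.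
    rewrite -[RHS]scalerA; congr (_ *: _); rewrite CE.
    apply/matrixP => i j; rewrite !mxE.
    by case: (i == j); rewrite /=; field.
rewrite !big_ord_recl big_ord0 /= addr0.
apply/matrixP => i j; rewrite !mxE.
by case: (i == j); rewrite /=; field; apply/andP.
Qed.

(** The last two conditions are those of [peak_state_transferP] for [r] and [s],
    with the entries of the projections multiplied by [(r - s) * n > 0]. *)
Lemma connected_peak (u v : G) t : peak_state_transfer R u v t <->
  [/\ u != v, (0 < t)%N,
    chebyshev (r / K) t * (N * (adj u v)%:R - (K - s))
      = `|N * (adj u v)%:R - (K - s)|
  & chebyshev (s / K) t * (K - r - N * (adj u v)%:R)
      = `|K - r - N * (adj u v)%:R| ].
Proof.
have := peak_state_transferP (srg_no_isolated Gsr) connected_decomposition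
  t (i0 := ord0) (u := u) (v := v) => /= ->; first last.
- by rewrite !mxE mulr1 invr_gt0.
- by [].
- case=> [[|[|[|//]]] ?] /=; first by rewrite normr1.
    rewrite ger0_norm; last by rewrite divr_ge0 ?srg_eigen_ge0 ?ltW.
    by rewrite ler_pdivrMr// mul1r ltW// srg_eigen_lt.
  rewrite ler0_norm; last by rewrite pmulr_lle0 ?invr_gt0// srg_eigen_le0.
  by rewrite lerNl ler_pdivlMr// mulN1r srg_eigen_ge.
have [->|uv] := eqVneq u v; first by split=> -[].
have d0 : 0 < ((r - s) * N)^-1 by rewrite invr_gt0 mulr_gt0// subr_gt0.
have rE : projr (enum_rank u) (enum_rank v)
    = ((r - s) * N)^-1 * (N * (adj u v)%:R - (K - s)).
  rewrite !mxE !enum_rankK (inj_eq enum_rank_inj) (negPf uv) /=.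
  by field; apply/andP.
have sE : projs (enum_rank u) (enum_rank v)
    = ((r - s) * N)^-1 * (K - r - N * (adj u v)%:R).
  rewrite !mxE !enum_rankK (inj_eq enum_rank_inj) (negPf uv) /=.
  by field; apply/andP.
have scale (x y : R) : (x * (((r - s) * N)^-1 * y) = `|((r - s) * N)^-1 * y|)
    <-> x * y = `|y|.
  rewrite normrM (gtr0_norm d0) mulrCA; split=> [|->//].
  by apply: mulfI; rewrite gt_eqF.
split=> [[_ t0 eqF]|[_ t0 eqr eqs]]; split=> //.
- by apply/scale; rewrite -rE; exact: (eqF (Ordinal (isT : (1 < 3)%N))).
- by apply/scale; rewrite -sE; exact: (eqF (Ordinal (isT : (2 < 3)%N))).
case=> [[|[|[|//]]] ?] /=.
- rewrite chebyshev1 mul1r ger0_norm// !mxE mulr1 invr_ge0 ltW//.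
- by rewrite rE; apply/scale.
- by rewrite sE; apply/scale.
Qed.

End Connected.
End Peak.

(** * The parameters of strongly regular graphs with peak state transfer *)

Section PeakParameters.
Import Order.TTheory GRing.Theory Num.Theory.
Local Open Scope ring_scope.

Lemma int_between0_2 (x : rat) : x \is a Num.int -> 0 < x -> x < 2 -> x = 1.
Proof.
move=> /intrP[z ->]; rewrite (ltr_int rat 0) (ltr_int rat z 2) => z0 z2.
by have -> : z = 1 by lia.
Qed.

Lemma int_between_neg2_0 (x : rat) :
  x \is a Num.int -> -2 <= x -> x < 0 -> x = -2 \/ x = -1.
Proof.
move=> /intrP[z ->]; rewrite (ler_int rat (-2)) (ltr_int rat z 0) => z2 z0.
have [->|->] : z = -2 \/ z = -1 by lia.
  by left.
by right.
Qed.

(** The first equation reads [(k - 2) ^ 2 = 4 * (1 - c)]. *)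
Lemma square_eq_small (k c : nat) :
  (k * k + 4 * c = 4 * k)%N -> (0 < c)%N -> k = 2%N /\ c = 1%N.
Proof.
move=> kk c0; have k3 : (k <= 3)%N by nia.
have [kE|[kE|[kE|kE]]] : k = 0%N \/ k = 1%N \/ k = 2%N \/ k = 3%N by lia.
all: by move: kk; rewrite kE; lia.
Qed.

Variables (R : realType) (G : sgraph) (n k a c : nat).
Hypothesis Gsr : strongly_regular G n k a c.

Local Notation N := (n%:R : R).
Local Notation K := (k%:R : R).
Local Notation Aa := (a%:R : R).
Local Notation Cc := (c%:R : R).

Lemma srg_eigenvalues_exist : exists r s : R,
  [/\ r + s = Aa - Cc, r * s = Cc - K & s < r].
Proof.
have ck : Cc <= K by rewrite ler_nat (srg_nonadj_le_degree Gsr).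
have ak : Aa < K by rewrite ltr_nat (srg_adj_lt_degree Gsr).
pose d := (Aa - Cc) ^+ 2 + 4 * (K - Cc).
have d0 : 0 < d.
  rewrite /d; have [e|ne] := eqVneq Cc K.
    by rewrite e subrr mulr0 addr0 lt_def sqr_ge0 sqrf_eq0 subr_eq0 lt_eqF.
  have : 0 < K - Cc by rewrite subr_gt0 lt_neqAle ne.
  have := sqr_ge0 (Aa - Cc); lra.
have dE : Num.sqrt d ^+ 2 = d by rewrite sqr_sqrtr// ltW.
have q0 : 0 < Num.sqrt d by rewrite sqrtr_gt0.
exists ((Aa - Cc + Num.sqrt d) / 2), ((Aa - Cc - Num.sqrt d) / 2); split.
- by field.
- transitivity (((Aa - Cc) ^+ 2 - Num.sqrt d ^+ 2) / 4); first by field.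
  by rewrite dE /d; field.
- by lra.
Qed.

(** If [r] is irrational, then [r] and [s] are conjugate and the two
    Chebyshev values agree. If [r] is rational, then [2 r / k] and [2 s / k] are integers, and the
    only parameters that this leaves are those of a triangle, which is
    complete. *)
Lemma primitive_no_chebyshev (r s : R) t (e : rat) :
  (0 < c)%N -> (c < k)%N -> r + s = Aa - Cc -> r * s = Cc - K -> s < r ->
  e ^+ 2 = 1 -> chebyshev (r / K) t.+1 = ratr e ->
  chebyshev (s / K) t.+1 = ratr (- e) -> False.
Proof.
move=> c0 ck rDs rMs sr e2 Tr Ts.
have k0 : (0 < k)%N by exact: (srg_degree_gt0 Gsr).
have K0 : K != 0 by rewrite pnatr_eq0 -lt0n.
have kR0 : (k%:R : rat) != 0 by rewrite pnatr_eq0 -lt0n.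
have xDy : r / K + s / K = ratr ((a%:R - c%:R) / k%:R).
  by rewrite -mulrDl rDs fmorph_div rmorphB /= !ratr_nat.
have xMy : (r / K) * (s / K) = ratr ((c%:R - k%:R) / k%:R ^+ 2).
  rewrite mulf_div rMs fmorph_div rmorphB /= rmorphXn /= !ratr_nat.
  by rewrite expr2.
have [[z rz]|irr] := pselect (exists z : rat, r / K = ratr z); last first.
  have irr' z : r / K <> ratr z by move=> E; apply: irr; exists z.
  have := chebyshev_irrational_conj xDy xMy irr' Tr; rewrite Ts => /fmorph_inj.
  by move=> ee; move: e2; rewrite (_ : e = 0) ?expr0n//; lra.
pose w : rat := (a%:R - c%:R) / k%:R - z.
have sw : s / K = ratr w.
  by rewrite rmorphB /= -xDy -rz addrC addKr.
have zw : z * w = (c%:R - k%:R) / k%:R ^+ 2.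
  by apply: (@fmorph_inj _ _ (@ratr R)); rewrite rmorphM /= -rz -sw xMy.
have zDw : z + w = (a%:R - c%:R) / k%:R by rewrite /w; ring.
move: Tr Ts; rewrite rz sw !rmorph_chebyshev => /fmorph_inj Tz /fmorph_inj Tw.
have zint : 2 * z \is a Num.int.
  by apply: (@chebyshev_rat_half_int _ t); rewrite Tz.
have wint : 2 * w \is a Num.int.
  by apply: (@chebyshev_rat_half_int _ t); rewrite Tw sqrrN.
have Kgt0 : 0 < K by rewrite ltr0n.
have z0 : 0 <= z.
  by rewrite -(ler0q R) -rz divr_ge0 ?(srg_eigen_ge0 Gsr rMs sr)// ltW.
have z1 : z < 1.
  rewrite -(ltr_rat R) -rz rmorph1 ltr_pdivrMr// mul1r.
  exact: (srg_eigen_lt Gsr c0 rDs rMs sr).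
have w0 : w <= 0.
  rewrite -(lerq0 R) -sw pmulr_lle0 ?invr_gt0//.
  exact: (srg_eigen_le0 Gsr rMs sr).
have w1 : -1 <= w.
  rewrite -(ler_rat R) -sw rmorphN1 ler_pdivlMr// mulN1r.
  exact: (srg_eigen_ge Gsr rDs rMs sr).
have zw0 : z * w != 0.
  rewrite zw mulf_neq0 ?invr_eq0 ?expf_neq0//.
  by rewrite subr_eq0 eqr_nat ltn_eqF.
have {}z0 : 0 < z.
  rewrite lt_neqAle z0 andbT eq_sym.
  by apply: contraNneq zw0 => ->; rewrite mul0r.
have {}w0 : w < 0.
  by rewrite lt_neqAle w0 andbT; apply: contraNneq zw0 => ->; rewrite mulr0.
have z2 : z = 2^-1 by have z21 := int_between0_2 zint; lra.
have eN : (k%:R : rat) * (z + w) = a%:R - c%:R by rewrite zDw mulrC divfK.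
have fN : (k%:R : rat) ^+ 2 * (z * w) = c%:R - k%:R.
  by rewrite zw mulrC divfK// expf_neq0.
have [w2|w2] : w = -1 \/ w = - 2^-1.
  by have [||wE|wE] := int_between_neg2_0 wint; [lra|lra|left; lra|right; lra].
- have kk : (k * k + 2 * c = 2 * k)%N.
    apply/eqP; rewrite -(eqr_nat rat) !natrD !natrM; apply/eqP.
    by move: fN; rewrite z2 w2 => fN; lra.
  by clear - kk c0 k0; nia.
- have ac : a = c.
    apply/eqP; rewrite -(eqr_nat rat); apply/eqP.
    by move: eN; rewrite z2 w2 => eN; lra.
  have kk : (k * k + 4 * c = 4 * k)%N.
    apply/eqP; rewrite -(eqr_nat rat) !natrD !natrM; apply/eqP.
    by move: fN; rewrite z2 w2 => fN; lra.
  have [k2 c1] := square_eq_small kk c0.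
  move: (srg_count_nat Gsr R) (srg_degree_lt_order Gsr).
  by rewrite ac k2 c1; clear; lia.
Qed.

Lemma srg_peak_params : has_peak_state_transfer R G <->
  [\/ k = 1%N, c = k /\ a = 0%N | c = k /\ k = (2 * a)%N].
Proof.
have k0 : (0 < k)%N by exact: (srg_degree_gt0 Gsr).
have kn := srg_degree_lt_order Gsr.
have ak := srg_adj_lt_degree Gsr.
have ck := srg_nonadj_le_degree Gsr.
have cnt := srg_count_nat Gsr R.
have Kgt0 : 0 < K by rewrite ltr0n.
have [c0|c0] := posnP c.
  have peakE := disconnected_peak R Gsr c0.
  split=> [[u [v [[|t] /peakE[uv// _ T]]]]|].
    have kr0 : (0 : rat) < k%:R by rewrite ltr0n.
    have Tq : chebyshev (- (k%:R)^-1 : rat) t.+1 = -1.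
      apply: (@fmorph_inj _ _ (@ratr R)).
      by rewrite -rmorph_chebyshev rmorphN fmorphV rmorph_nat T rmorphN1.
    have xint : 2 * (- (k%:R)^-1) \is a @Num.int rat.
      by apply: (@chebyshev_rat_half_int _ t); rewrite Tq sqrrN expr1n.
    have mk : 2 * (- (k%:R)^-1) * k%:R = -2 :> rat.
      by rewrite -mulrA mulNr mulVf ?gt_eqF// mulrN1.
    have [||m2|m1] := int_between_neg2_0 xint.
    - have : (k%:R : rat)^-1 <= 1 by rewrite invf_le1// ler1n.
      by lra.
    - have : 0 < (k%:R : rat)^-1 by rewrite invr_gt0.
      by lra.
    - apply: Or31; apply/eqP; rewrite -(eqr_nat rat); apply/eqP.
      by move: mk; rewrite m2 => mk; lra.
    have k2 : k%:R = 2 :> rat by move: mk; rewrite m1 => mk; lra.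
    by case: (@chebyshev_neg_half rat t.+1); rewrite -k2.
  case=> [k1|[]|[]]; [|by clear - c0 k0; lia|by clear - c0 k0; lia].
  have [u [v uv]] := srg_edge Gsr.
  by exists u, v, 1%N; apply/peakE; split=> //; rewrite /= k1 invr1.
have [r [s [rDs rMs sr]]] := srg_eigenvalues_exist.
have peakE := connected_peak Gsr c0 rDs rMs sr.
have rK : r < K by exact: (srg_eigen_lt Gsr c0 rDs rMs sr).
have s0 : s <= 0 by exact: (srg_eigen_le0 Gsr rMs sr).
have r0 : 0 <= r by exact: (srg_eigen_ge0 Gsr rMs sr).
have NK : K + 1 < N by rewrite natr1 ltr_nat.
have multi : c = k -> r = 0 /\ s = Aa - K.
  move=> cE; have sE : r * s = 0 by rewrite rMs cE subrr.
  have aK : Aa < K by rewrite ltr_nat.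
  have rs' : r + s = Aa - K by rewrite rDs cE.
  by move/eqP: sE; rewrite mulf_eq0 => /orP[]/eqP E; lra.
have sgn_pos (x y : R) : 0 < y -> x * y = `|y| -> x = 1.
  move=> y0; rewrite gtr0_norm// => E.
  apply: (@mulIf _ y); last by rewrite mul1r.
  by rewrite gt_eqF.
have sgn_neg (x y : R) : y < 0 -> x * y = `|y| -> x = -1.
  move=> y0; rewrite ltr0_norm// => E.
  apply: (@mulIf _ y); last by rewrite mulN1r.
  by rewrite lt_eqF.
split=> [[u [v [[|t] /peakE[uv// _ Tr Ts]]]]|].
  have [ckE|ckN] := eqVneq c k; last first.
    have {}ck : (c < k)%N by rewrite ltn_neqAle ckN.
    exfalso; move: Tr Ts; case: (adj u v) => /=; rewrite ?mulr1 ?mulr0 ?subr0.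
      (* The product of N - K + s with N - K + r > 0 is N (N - 2K + a), and
         c (N - 2K + a) = (K - c) (K - a - 1) is positive. *)
      have pos : 0 < N - K + s.
        have E : (N - K + r) * (N - K + s) = N * (N - 2 * K + Aa).
          transitivity ((N - K) ^+ 2 + (r + s) * (N - K) + r * s).
            by ring.
          rewrite rDs rMs.
          transitivity (N ^+ 2 - 2 * N * K + (Aa - Cc) * N + N * Cc).
            by rewrite (srg_count Gsr R); ring.
          by ring.
        have F : Cc * (N - 2 * K + Aa) = (K - Cc) * (K - Aa - 1).
          transitivity (N * Cc - 2 * K * Cc + Aa * Cc); first by ring.
          by rewrite (srg_count Gsr R); ring.
        have a1 : (a.+1 < k)%N.
          rewrite ltn_neqAle ak andbT; apply/eqP => a1.
          have : (n * c = k.+1 * c)%N by clear - a1 cnt; nia.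
          by move/eqP; rewrite eqn_pmul2r// => /eqP; lia.
        have : 0 < N * (N - 2 * K + Aa).
          apply: mulr_gt0; first by lra.
          have : 0 < Cc * (N - 2 * K + Aa).
            rewrite F mulr_gt0 ?subr_gt0 ?ltr_nat//.
            by rewrite ltrBrDr nat1r ltr_nat.
          by rewrite pmulr_rgt0// ltr0n.
        by rewrite -E pmulr_rgt0//; lra.
      move=> /sgn_pos Tr /sgn_neg Ts.
      apply: (@primitive_no_chebyshev r s t 1) => //.
      + by rewrite rmorph1; apply: Tr; lra.
      + by rewrite rmorphN1; apply: Ts; lra.
    move=> /sgn_neg Tr /sgn_pos Ts.
    apply: (@primitive_no_chebyshev r s t (-1)) => //.
    + by rewrite rmorphN1; apply: Tr; lra.
    + by rewrite opprK rmorph1; apply: Ts; lra.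
  have [rE sE] := multi ckE.
  pose x : rat := (a%:R - k%:R) / k%:R.
  have kr0 : (0 : rat) < k%:R by rewrite ltr0n.
  have xE : s / K = ratr x by rewrite fmorph_div rmorphB /= !ratr_nat sE.
  have T2 : chebyshev x t.+1 ^+ 2 = 1.
    apply: (@fmorph_inj _ _ (@ratr R)); rewrite rmorphXn rmorph1.
    have Tx : chebyshev (s / K) t.+1 = ratr (chebyshev x t.+1).
      by rewrite xE rmorph_chebyshev.
    rewrite -[X in X ^+ 2]Tx.
    move: Ts; case: (adj u v) => /=; rewrite ?mulr1 ?mulr0 ?subr0.
      by move/sgn_neg => ->; [rewrite sqrrN expr1n | lra].
    by move/sgn_pos => ->; [rewrite expr1n | lra].
  have xk : 2 * x * k%:R = 2 * (a%:R - k%:R) by rewrite -mulrA divfK ?gt_eqF.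
  have ar0 : (0 : rat) <= a%:R by rewrite ler0n.
  have akr : (a%:R : rat) < k%:R by rewrite ltr_nat.
  have [||x2|x1] := int_between_neg2_0 (chebyshev_rat_half_int T2).
  - by rewrite -(ler_pM2r kr0) xk; lra.
  - by rewrite -(ltr_pM2r kr0) xk mul0r; lra.
  - apply: Or32; split=> //; apply/eqP; rewrite -(eqr_nat rat); apply/eqP.
    by move: xk; rewrite x2 => xk; lra.
  apply: Or33; split=> //; apply/eqP; rewrite -(eqr_nat rat) natrM; apply/eqP.
  by move: xk; rewrite x1 => xk; lra.
(* T_6 is -1 at 0 and 1 at both -1 and -1/2. *)
have time6 : c = k -> chebyshev (s / K) 6 = 1 -> has_peak_state_transfer R G.
  move=> cE Ts; have [rE sE] := multi cE.
  have [u [v [uv /negPf nuv]]] := srg_nonedge Gsr.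
  exists u, v, 6%N; apply/peakE.
  rewrite nuv Ts rE mul0r mulr0 subr0; split=> //.
    rewrite sub0r normrN gtr0_norm; last by lra.
    by rewrite /=; ring.
  by rewrite mul1r !subr0 gtr0_norm.
case=> [k1|[cE aE]|[cE kE]]; first by clear - k1 c0 ck cnt kn; subst; nia.
  apply: time6 => //; have [_ ->] := multi cE.
  by rewrite aE sub0r mulNr divff ?gt_eqF//=; ring.
apply: time6 => //; have [_ ->] := multi cE.
have a0 : Aa != 0 by rewrite pnatr_eq0; clear - kE k0; lia.
rewrite (_ : (Aa - K) / K = - 2^-1); last by rewrite kE natrM; field.
by rewrite /=; field.
Qed.

End PeakParameters.

(** * Complete multipartite graphs and disjoint unions of complete graphs *)

Section Partitions.

(** The [q] classes have [m] elements each; [f] numbers the classes, and the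
    elements within each class. *)
Lemma uniform_equivalence_bij (T : finType) (E : rel T) (m q : nat) :
  equivalence_rel E -> (forall x, #|[set y | E x y]| = m) -> (0 < m)%N ->
  #|T| = (q * m)%N ->
  exists2 f : T -> 'I_q * 'I_m, bijective f &
    forall x y, ((f x).1 == (f y).1) = E x y.
Proof.
move=> eqE cardE m0 cardT.
pose C x := [set y | E x y]; pose P := [set C x | x in [set: T]].
have CE x y : (C x == C y) = E x y.
  apply/eqP/idP => [/setP/(_ y)|Exy].
    by rewrite !inE => ->; have [] := eqE y y y.
  by apply/setP => z; rewrite !inE; have [_ ->] := eqE x y z.
have cardP : #|P| = q.
  have PE : P = equivalence_partition E [set: T].
    by apply: eq_imset => x; apply/setP => y; rewrite !inE.
  have partP : partition P [set: T].
    by rewrite PE; apply: equivalence_partitionP => x y z _ _ _; apply: eqE.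
  have uniP : {in P, forall B : {set T}, #|B| = m}.
    by move=> _ /imsetP[x _ ->]; exact: cardE.
  apply/eqP; rewrite -(eqn_pmul2r m0) -(card_uniform_partition uniP partP).
  by rewrite cardsT cardT.
have CP x : C x \in P by apply: imset_f.
have b_lt x : (index (C x) (enum P) < q)%N.
  by rewrite -cardP fintype.cardE index_mem mem_enum.
have i_lt x : (index x (enum (C x)) < m)%N.
  rewrite -(cardE x) fintype.cardE index_mem mem_enum inE.
  by have [] := eqE x x x.
pose f x := (Ordinal (b_lt x), Ordinal (i_lt x)).
have fE x y : ((f x).1 == (f y).1) = E x y.
  rewrite -CE -val_eqE /=; apply/eqP/eqP => [|-> //].
  by apply: (index_inj (C x)); rewrite mem_enum.
exists f => //; apply: inj_card_bij.
  move=> x y fxy; have /eqP Cxy : C x == C y by rewrite CE -fE fxy.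
  have := congr1 (fun p => val p.2) fxy; rewrite /= -Cxy.
  apply: (index_inj x); rewrite mem_enum ?Cxy inE.
    by rewrite -CE Cxy.
  by have [] := eqE y y y.
by rewrite cardT card_prod !card_ord.
Qed.

Lemma card_bij_fiber (T : finType) (m q : nat) (f : T -> 'I_q * 'I_m) x :
  bijective f -> #|[set y | (f y).1 == (f x).1]| = m.
Proof.
move=> bij_f; pose S := setX [set (f x).1] [set: 'I_m].
rewrite (_ : [set y | _] = f @^-1: S); last first.
  by apply/setP => y; rewrite !inE andbT.
rewrite on_card_preimset; last exact: onW_bij.
by rewrite cardsX cards1 cardsT card_ord mul1n.
Qed.

Variables (G : sgraph) (n k a c : nat).
Hypothesis Gsr : strongly_regular G n k a c.

Lemma copies_params m : graph_iso G (copies_of_complete m 2) -> k = 1.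
Proof.
case=> f bij_f adjE; case: (Gsr) => _ _ _ dk _; have [u _] := srg_edge Gsr.
have := card_bij_fiber u bij_f.
rewrite (cardsD1 u) inE eqxx add1n => -[<-].
rewrite -(dk u); apply: eq_card => v; rewrite !inE -adjE /= /copies_rel.
rewrite -(inj_eq (bij_inj bij_f) v u).
case: (f u) (f v) => [i x] [j y] /=; rewrite xpair_eqE (eq_sym j) (eq_sym y).
by case: (i == j); case: (x == y).
Qed.

Lemma copies_iso : k = 1 -> graph_iso G (copies_of_complete (n %/ 2) 2).
Proof.
move=> k1; case: (Gsr) => nG _ _ dk _.
have uniq_nbr (u v w : G) : adj u v -> adj u w -> v = w.
  have /eqP/cards1P[x xE] : #|[set v | adj u v]| = 1.
    by have := dk u; rewrite k1.
  move=> uv uw; have vx : v \in [set v | adj u v] by rewrite inE.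
  have : w \in [set v | adj u v] by rewrite inE.
  by move: vx; rewrite xE !inE => /eqP-> /eqP->.
pose E := [rel u v : G | (u == v) || adj u v].
have symE u v : E u v = E v u by rewrite /= eq_sym adj_sym.
have trE u v w : E u v -> E u w -> E v w.
  rewrite /= => /orP[/eqP<-//|uv] /orP[/eqP<-|uw].
    by rewrite adj_sym uv orbT.
  by rewrite (uniq_nbr u v w)// eqxx.
have eqE : equivalence_rel E.
  move=> u v w; split=> [|uv]; first by rewrite /= eqxx.
  by apply/idP/idP; [exact: trE | apply: trE; rewrite symE].
have cardE u : #|[set v | E u v]| = 2.
  rewrite (cardsD1 u) inE /= eqxx add1n; congr _.+1.
  rewrite -k1 -(dk u); apply: eq_card => v; rewrite !inE eq_sym.
  by case: eqVneq => [->|]; rewrite ?adj_irr.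
have dvd2 : 2 %| n.
  have partP := equivalence_partitionP (D := [set: G])
    (fun x y z _ _ _ => eqE x y z).
  have uniP : {in equivalence_partition E [set: G],
      forall B : {set G}, #|B| = 2}.
    move=> _ /imsetP[u _ ->]; rewrite -(cardE u); apply: eq_card => v.
    by rewrite !inE.
  by rewrite -nG -cardsT (card_uniform_partition uniP partP) dvdn_mull.
have cardG : #|G| = n %/ 2 * 2 by rewrite nG divnK.
have [f bij_f fE] := uniform_equivalence_bij eqE cardE isT cardG.
exists f => // u v; rewrite /= /copies_rel fE /=.
have fuv : ((f u) == (f v)) = (u == v) by exact/inj_eq/bij_inj.
have [uv|nuv] /= := eqVneq u v; first by rewrite uv eqxx adj_irr.
have := fE u v; rewrite /= (negPf nuv) /= => <-; case: eqVneq => //= f1.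
move: fuv; rewrite (negPf nuv) => /negbT; apply: contraNneq => f2.
by rewrite [f u]surjective_pairing [f v]surjective_pairing f1 f2.
Qed.

(** When [c = k] nonadjacent vertices have the same neighbours. *)
Lemma srg_twins (u v w : G) : c = k -> ~~ adj u v -> adj u w = adj v w.
Proof.
move=> ck; have [->//|uv] := eqVneq u v => nuv.
case: (Gsr) => _ _ _ dk com; have := com u v uv; rewrite (negPf nuv) ck => cuv.
have sub (x y : G) : common_nbrs x y = k -> adj x w -> adj y w.
  move=> cxy; have : [set z | adj x z && adj y z] = [set z | adj x z].
    apply/eqP; rewrite eqEcard; apply/andP; split.
      by apply/subsetP => z; rewrite !inE => /andP[].
    by rewrite -[X in X <= _]/(deg x) -[X in _ <= X]/(common_nbrs x y) dk cxy.
  by move/setP/(_ w); rewrite !inE; case: (adj x w) => //= ->.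
apply/idP/idP; apply: sub => //.
by rewrite -cuv; apply: eq_card => z; rewrite !inE andbC.
Qed.

Lemma multipartite_iso q : c = k -> n = q * (n - k) ->
  graph_iso G (complete_multipartite (n - k) q).
Proof.
move=> ck nE; case: (Gsr) => nG _ _ dk _.
pose E := [rel u v : G | ~~ adj u v].
have eqE : equivalence_rel E.
  move=> u v w; split=> [|uv]; first by rewrite /= adj_irr.
  by rewrite /= (srg_twins w ck uv).
have cardE u : #|[set v | E u v]| = n - k.
  rewrite -(dk u) -nG cardsCs; congr (_ - _); apply: eq_card => v.
  by rewrite !inE negbK.
have m0 : 0 < n - k.
  by rewrite subn_gt0; apply: ltnW; exact: (srg_degree_lt_order Gsr).
have cardG : #|G| = q * (n - k) by rewrite nG.
have [f bij_f fE] := uniform_equivalence_bij eqE cardE m0 cardG.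
by exists f => // u v; rewrite /= /multipartite_rel fE /= negbK.
Qed.

Lemma multipartite_params m q : graph_iso G (complete_multipartite m q) ->
  [/\ c = k, n = q * m & k + m = n].
Proof.
case=> f bij_f adjE; case: (Gsr) => nG _ _ dk com.
have adjP u v : adj u v = ((f u).1 != (f v).1) by rewrite -adjE.
split.
- have [u [v [uv nuv]]] := srg_nonedge Gsr.
  have := com u v uv; rewrite (negPf nuv) => <-; rewrite -(dk u).
  apply: eq_card => w; rewrite !inE !adjP.
  by move: nuv; rewrite adjP negbK => /eqP->; rewrite andbb.
- by rewrite -nG (bij_eq_card bij_f) card_prod !card_ord.
have [u _] := srg_edge Gsr.
rewrite -(card_bij_fiber u bij_f) -(dk u) -nG -(cardsC [set v | adj u v]).
congr (_ + _); apply: eq_card => v.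
by rewrite !inE adjP negbK eq_sym.
Qed.

End Partitions.

Theorem theorem5p3 (R : realType) (X : sgraph) (n k a c : nat)
    (hX : strongly_regular X n k a c) :
  has_peak_state_transfer R X <->
  [\/ graph_iso X (copies_of_complete (n %/ 2) 2),
      graph_iso X (complete_multipartite (n %/ 2) 2)
    | graph_iso X (complete_multipartite (n %/ 3) 3)].
Proof.
have k0 := srg_degree_gt0 hX.
have cnt := srg_count_nat hX R.
(* For c = k the count reads n + a = 2k. *)
have cntk : c = k -> n + a = 2 * k.
  move=> ck; apply/eqP; rewrite -(eqn_pmul2r k0); apply/eqP; nia.
split=> [/(srg_peak_params R hX)[k1|[ck a0]|[ck ka]]|].
- by apply: Or31; exact: copies_iso hX k1.
- have nk := cntk ck; have n2 : n %/ 2 = n - k by lia.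
  by apply: Or32; rewrite n2; apply: (multipartite_iso hX ck); lia.
- have nk := cntk ck; have n3 : n %/ 3 = n - k by lia.
  by apply: Or33; rewrite n3; apply: (multipartite_iso hX ck); lia.
move=> iso; apply/(srg_peak_params R hX).
case: iso => [/(copies_params hX)|/(multipartite_params hX)
  |/(multipartite_params hX)].
- exact: Or31.
- by case=> ck nE kE; have := cntk ck => nk; apply: Or32; split=> //; lia.
- by case=> ck nE kE; have := cntk ck => nk; apply: Or33; split=> //; lia.
Qed.
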